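(* For a semi-ring $\mathcal{S}$ of subsets of a set $\Omega$, $\mathrm{ca}(\mathcal{S})$ is a projection band in $\mathrm{fa}(\mathcal{S})$. In particular, we have the decomposition $$\mathrm{fa}(\mathcal{S})=\mathrm{ca}(\mathcal{S})\oplus\mathrm{ca}(\mathcal{S})^d .$$
   Context: A semi-ring $\mathcal{S}$ of subsets of $\Omega$ is a family with $\emptyset\in\mathcal{S}$, closed under finite intersections, and such that for $A,B\in\mathcal{S}$ the set $A\setminus B$ is a finite disjoint union of elements of $\mathcal{S}$. A signed charge on $\mathcal{S}$ is a set function $\mu:\mathcal{S}\to[-\infty,\infty]$ with $\mu(\emptyset)=0$ that avoids at least one of the values $+\infty,-\infty$ and is finitely additive (for finite families of pairwise disjoint elements of $\mathcal{S}$ whose union is in $\mathcal{S}$). A signed measure is a countably additive signed charge, i.e. $\mu(\bigcup_n A_n)=\sum_n\mu(A_n)$ for every sequence of pairwise disjoint elements of $\mathcal{S}$ with union in $\mathcal{S}$. The variation of $\mu$ is $|\mu|(A)=\sup_{\Pi}\sum_{C\in\Pi}|\mu(C)|$, where $\Pi$ ranges over all finite partitions of $A$ by elements of $\mathcal{S}$; it is the least upper bound of $\{-\mu,\mu\}$ among signed charges for the pointwise order. $\mathrm{fa}(\mathcal{S})$ is the set of all real-valued signed charges $\mu$ on $\mathcal{S}$ such that $|\mu|$ takes only finite values, and $\mathrm{ca}(\mathcal{S})$ the set of all real-valued signed measures $\mu$ on $\mathcal{S}$ such that $|\mu|$ takes only finite values. $\mathrm{fa}(\mathcal{S})$ is a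 Riesz space with pointwise operations and pointwise order ($\mu\le\nu\iff\mu(A)\le\nu(A)$ for all $A\in\mathcal{S}$). In a Riesz space $E$, an ideal is a solid vector subspace ($|x|\le|y|$, $y\in F$ imply $x\in F$), a band is an order closed ideal, the disjoint complement of $B\subseteq E$ is $B^d=\{x\in E:|x|\wedge|y|=0\ \forall y\in B\}$, and a band $B$ is a projection band if $E=B\oplus B^d$. *)

(* Defs.v *)
From HB Require Import structures.
From mathcomp Require Import all_boot all_order all_algebra.
From mathcomp Require Import all_classical all_reals.
From mathcomp Require Import ereal topology normedtype sequences.
From mathcomp Require Import measurable_structure.
From mathcomp Require Import lra.

Set Implicit Arguments.
Unset Strict Implicit.
Unset Printing Implicit Defensive.

Import Order.TTheory GRing.Theory Num.Theory.
Import numFieldNormedType.Exports.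

Local Open Scope classical_set_scope.
Local Open Scope ring_scope.

(* The lattice operations are fields of the mixin because the hierarchy has no
   join of [Order.Lattice] with additive structures other than number domains,
   so [Order.Lattice] cannot be combined with [GRing.Lmodule]. *)
HB.mixin Record POrderedLmodule_isRiesz (R : numDomainType) E
    & GRing.Lmodule R E & Order.POrder ring_display E := {
  riesz_leD : forall x y z : E, x <= y -> x + z <= y + z;
  riesz_leZ : forall (a : R) (x : E), 0 <= a -> 0 <= x -> 0 <= a *: x;
  riesz_join : E -> E -> E;
  riesz_meet : E -> E -> E;
  riesz_joinP : forall x y z : E,
    (riesz_join x y <= z) = (x <= z) && (y <= z);
  riesz_meetP : forall x y z : E,
    (z <= riesz_meet x y) = (z <= x) && (z <= y)
}.

#[short(type="rieszType")]
HB.structure Definition Riesz (R : numDomainType) :=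
  {E of GRing.Lmodule R E & Order.POrder ring_display E
      & POrderedLmodule_isRiesz R E}.

Definition is_directed (I : Type) (le : I -> I -> Prop) : Prop :=
  [/\ inhabited I, forall i, le i i,
      forall i j k, le i j -> le j k -> le i k &
      forall i j, exists k, le i k /\ le j k].

Section RieszNotions.
Context {R : numDomainType} {E : rieszType R}.
Implicit Types (x y : E) (F B C : set E).

Definition riesz_abs x : E := riesz_join x (- x).

Definition disjoint_elts x y : Prop :=
  riesz_meet (riesz_abs x) (riesz_abs y) = 0.

Definition disjoint_complement B : set E :=
  [set x | forall y, B y -> disjoint_elts x y].

Definition vector_subspace F : Prop :=
  F 0 /\ forall (a : R) x y, F x -> F y -> F (a *: x + y).

Definition solid F : Prop :=
  forall x y, riesz_abs x <= riesz_abs y -> F y -> F x.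

Definition is_ideal F : Prop := vector_subspace F /\ solid F.

Definition decreases_to0 (I : Type) (le : I -> I -> Prop) (y : I -> E) : Prop :=
  (forall i j, le i j -> y j <= y i) /\ infimums (range y) 0.

(* The dominating net has the same index set as [u]. Allowing a different
   index set for it gives the same order closed sets. *)
Definition order_cvg (I : Type) (le : I -> I -> Prop) (u : I -> E) x : Prop :=
  exists y : I -> E,
    decreases_to0 le y /\ forall i, riesz_abs (u i - x) <= y i.

Definition order_closed F : Prop :=
  forall (I : Type) (le : I -> I -> Prop) (u : I -> E) x,
    is_directed le -> (forall i, F (u i)) -> order_cvg le u x -> F x.

Definition is_band B : Prop := is_ideal B /\ order_closed B.

Definition direct_sum_decomposition B C : Prop :=
  (forall x, exists b c, [/\ B b, C c & x = b + c]) /\ B `&` C = [set 0].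

Definition is_projection_band B : Prop :=
  is_band B /\ direct_sum_decomposition B (disjoint_complement B).

End RieszNotions.

(* The library's [semiRingOfSetsType] requires a pointed carrier, which would
   exclude the empty underlying set. *)
Record semiring_of_sets (T : Type) := SemiringOfSets {
  semiring_sets :> set (set T);
  semiring_set0 : semiring_sets set0;
  semiring_setI : setI_closed semiring_sets;
  semiring_setD : semi_setD_closed semiring_sets
}.

Section SetFunctions.
Context {R : realType} {T : Type} (S : semiring_of_sets T).

(* Set functions are defined on the type of elements of [S], so that their
   equality does not depend on values outside [S]. *)

Definition semiring0 : S := exist _ set0 (mem_set (semiring_set0 S)).

(* For [I] finite this represents the finite partitions of [A] into elements
   of [S]; blocks may be empty, and only the empty block can be repeated, which
   does not matter for set functions vanishing at the empty set. *)
Definition is_partition_of (I : Type) (F : I -> S) (A : S) : Prop :=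
  trivIset setT (fun i => val (F i)) /\ \bigcup_i val (F i) = val A.

Local Open Scope ereal_scope.

Definition signed_charge (mu : S -> \bar R) : Prop :=
  [/\ mu semiring0 = 0,
      (forall A, mu A != +oo) \/ (forall A, mu A != -oo) &
      forall (n : nat) (F : 'I_n -> S) (A : S),
        is_partition_of F A -> mu A = \sum_(i < n) mu (F i)].

Definition signed_measure (mu : S -> \bar R) : Prop :=
  signed_charge mu /\
  forall (F : nat -> S) (A : S), is_partition_of F A ->
    (fun n => \sum_(0 <= i < n) mu (F i)) @ \oo --> mu A.

Definition variation (mu : S -> \bar R) (A : S) : \bar R :=
  ereal_sup [set x | exists (n : nat) (F : 'I_n -> S),
    is_partition_of F A /\ x = \sum_(i < n) `|mu (F i)|].

Definition is_fa (mu : S -> R) : Prop :=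
  signed_charge (EFin \o mu) /\ forall A, variation (EFin \o mu) A < +oo.

Definition is_ca (mu : S -> R) : Prop :=
  signed_measure (EFin \o mu) /\ forall A, variation (EFin \o mu) A < +oo.

End SetFunctions.

Section Fa.
Context (R : realType) {T : Type} (S : semiring_of_sets T).

Definition fa_pred : {pred S -> R} := fun mu => `[< is_fa mu >].

Record fa := Fa { fa_fun :> S -> R; _ : fa_fun \in fa_pred }.

HB.instance Definition _ := [isSub for fa_fun].
HB.instance Definition _ := [Choice of fa by <:].

Lemma fa_is_fa (mu : fa) : is_fa mu.
Proof. by case: mu => f /= /asboolP. Qed.

Lemma partition_of_self (A : S) : is_partition_of (fun _ : 'I_1 => A) A.
Proof.
split; first by move=> i j _ _ _; rewrite (ord1 i) (ord1 j).
by apply/seteqP; split=> [x [i _]//|x Ax]; exists ord0.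
Qed.

Lemma partition_of_enum (I : finType) (F : I -> S) A : is_partition_of F A ->
  is_partition_of (fun k : 'I_#|I| => F (enum_val k)) A.
Proof.
move=> [tF UF]; split.
  by move=> i j _ _ /tF => /(_ Logic.I Logic.I); exact: enum_val_inj.
rewrite -UF; apply/seteqP; split=> [x [k _ Fx]|x [i _ Fx]].
  by exists (enum_val k).
by exists (enum_rank i) => //; rewrite enum_rankK.
Qed.

Lemma is_faP (mu : S -> R) : is_fa mu <->
  (forall (I : finType) (F : I -> S) A, is_partition_of F A ->
     mu A = \sum_i mu (F i)) /\
  (forall A, exists M, forall (I : finType) (F : I -> S),
     is_partition_of F A -> \sum_i `|mu (F i)| <= M).
Proof.
split=> [[[_ _ addmu] fin]|[addmu bnd]].
  split=> [I F A FA|A].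
    have /= := addmu _ _ _ (partition_of_enum FA).
    rewrite sumEFin => -[->].
    by rewrite (reindex (@enum_val I predT)) //=; exact/onW_bij/enum_val_bij.
  have VA : variation (EFin \o mu) A \is a fin_num.
    rewrite ge0_fin_numE ?fin//; apply: le_trans (_ : `|(mu A)%:E| <= _)%E => //.
    apply: ereal_sup_ubound; exists 1%N, (fun=> A).
    by split; [exact: partition_of_self|rewrite big_ord1].
  exists (fine (variation (EFin \o mu) A)) => I F FA.
  rewrite -lee_fin fineK//; apply: ereal_sup_ubound.
  exists _, (fun k : 'I_#|I| => F (enum_val k)).
  split; first exact: partition_of_enum.
  rewrite sumEFin (reindex (@enum_val I predT)) //=.
  exact/onW_bij/enum_val_bij.
split; first split.
- rewrite /= (addmu _ (fun _ : 'I_0 => semiring0 S)) ?big_ord0//.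
  by split=> [[]//|]; apply/seteqP; split=> [x [[]//]|x []].
- by left.
- by move=> n F A /addmu /= ->; rewrite sumEFin.
move=> A; have [M MA] := bnd A; apply: (@le_lt_trans _ _ M%:E); last exact: ltry.
apply: ge_ereal_sup => _ [n [F [FA ->]]].
by rewrite sumEFin lee_fin; exact: MA.
Qed.

Lemma fa_submod_closed : GRing.submod_closed fa_pred.
Proof.
split=> [|a mu nu /asboolP/is_faP[amu bmu] /asboolP/is_faP[anu bnu]].
  apply/asboolP/is_faP; split=> [I F A _|A]; first by rewrite big1.
  by exists 0 => I F _; rewrite big1// => i _; rewrite normr0.
apply/asboolP/is_faP; split=> [I F A FA|A].
  rewrite big_split/= -mulr_sumr -(amu _ _ _ FA) -(anu _ _ _ FA).
  by [].
have [[M HM] [N HN]] := (bmu A, bnu A).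
exists (`|a| * M + N) => I F FA.
apply: (@le_trans _ _ (\sum_i (`|a| * `|mu (F i)| + `|nu (F i)|))).
  apply: ler_sum => i _; rewrite -normrM; exact: ler_normD.
rewrite big_split/= -mulr_sumr lerD ?ler_wpM2l//; [exact: HM|exact: HN].
Qed.

HB.instance Definition _ := GRing.isSubmodClosed.Build R (S -> R) fa_pred
  (GRing.submod_closed_semi fa_submod_closed).
HB.instance Definition _ := [SubChoice_isSubLmodule of fa by <:].

Definition fa_le (mu nu : fa) : bool := `[< forall A, mu A <= nu A >].

Lemma fa_le_refl : reflexive fa_le.
Proof. by move=> mu; apply/asboolP. Qed.

Lemma fa_le_anti : antisymmetric fa_le.
Proof.
move=> mu nu /andP[/asboolP h /asboolP k]; apply/val_inj/funext => A.
by apply/eqP; rewrite eq_le h k.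
Qed.

Lemma fa_le_trans : transitive fa_le.
Proof.
by move=> b a c /asboolP h /asboolP k; apply/asboolP => A; exact: le_trans (k A).
Qed.

HB.instance Definition _ := Order.Le_isPOrder.Build ring_display fa
  fa_le_refl fa_le_anti fa_le_trans.

Lemma fa_leP (mu nu : fa) : reflect (forall A, mu A <= nu A) (mu <= nu).
Proof. exact: asboolP. Qed.

Definition fa_var (mu : fa) (A : S) : R := fine (variation (EFin \o mu) A).

Lemma fa_var_fin (mu : fa) A : variation (EFin \o mu) A \is a fin_num.
Proof.
have [_ /(_ A) fin] := fa_is_fa mu.
rewrite ge0_fin_numE//; apply: le_trans (_ : `|(mu A)%:E| <= _)%E => //.
apply: ereal_sup_ubound; exists 1%N, (fun=> A).
by split; [exact: partition_of_self|rewrite big_ord1].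
Qed.

Lemma fa_var_ub (mu : fa) (I : finType) (F : I -> S) A : is_partition_of F A ->
  \sum_i `|mu (F i)| <= fa_var mu A.
Proof.
move=> FA; rewrite -lee_fin fineK ?fa_var_fin//; apply: ereal_sup_ubound.
exists _, (fun k : 'I_#|I| => F (enum_val k)).
split; first exact: partition_of_enum.
rewrite sumEFin (reindex (@enum_val I predT)) //=.
exact/onW_bij/enum_val_bij.
Qed.

Lemma fa_var_ge0 (mu : fa) A : 0 <= fa_var mu A.
Proof.
by apply: le_trans (fa_var_ub mu (partition_of_self A)); exact: sumr_ge0.
Qed.

Lemma fa_var_least (mu : fa) A (M : R) :
  (forall (I : finType) (F : I -> S), is_partition_of F A ->
    \sum_i `|mu (F i)| <= M) -> fa_var mu A <= M.
Proof.
move=> h; rewrite -lee_fin fineK ?fa_var_fin//.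
apply: ge_ereal_sup => _ [n [F [FA ->]]].
by rewrite sumEFin lee_fin; exact: h.
Qed.

Lemma fa_additive (mu : fa) (I : finType) (F : I -> S) A :
  is_partition_of F A -> mu A = \sum_i mu (F i).
Proof. by have /is_faP[+ _] := fa_is_fa mu; exact. Qed.

Definition semiringI (A B : S) : S := exist _ (val A `&` val B)
  (mem_set (semiring_setI (set_valP A) (set_valP B))).

Lemma partition_ofI I (F : I -> S) A B : is_partition_of F A ->
  val B `<=` val A -> is_partition_of (fun i => semiringI B (F i)) B.
Proof.
move=> [tF UF] BA; split.
  move=> i j _ _ [x [[_ xi] [_ xj]]]; apply: tF => //; by exists x.
by rewrite -setI_bigcupr UF; apply/setIidPl.
Qed.

Lemma partition_of_sub I (F : I -> S) A i : is_partition_of F A ->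
  val (F i) `<=` val A.
Proof. by move=> [_ <-] x Fx; exists i. Qed.

Lemma fa_var_additive (mu : fa) (I : finType) (F : I -> S) A :
  is_partition_of F A -> fa_var mu A = \sum_i fa_var mu (F i).
Proof.
move=> FA; apply/eqP; rewrite eq_le; apply/andP; split.
  apply: fa_var_least => J G GA.
  apply: (@le_trans _ _ (\sum_j \sum_i `|mu (semiringI (G j) (F i))|)).
    apply: ler_sum => j _.
    rewrite (fa_additive mu (partition_ofI FA (partition_of_sub (i := j) GA))).
    exact: ler_norm_sum.
  rewrite exchange_big; apply: ler_sum => i _ /=.
  under eq_bigr => j _.
    have -> : semiringI (G j) (F i) = semiringI (F i) (G j).
      by apply: val_inj; rewrite /= setIC.
    over.
  exact/fa_var_ub/(partition_ofI GA (partition_of_sub (i := i) FA)).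
apply/ler_addgt0Pr => e e0.
have [c0|c0] := posnP #|I|.
  rewrite big1 ?addr_ge0 ?fa_var_ge0 ?(ltW e0)// => i _.
  by have := card0_eq c0 i; rewrite inE.
have d0 : 0 < e / #|I|%:R by rewrite divr_gt0 ?ltr0n.
have /fin_all_exists[n /fin_all_exists[G GP]] : forall i, exists n,
    exists G : 'I_n -> S, is_partition_of G (F i) /\
    fa_var mu (F i) <= \sum_k `|mu (G k)| + e / #|I|%:R.
  move=> i; have [_ [n [G [GF ->]]]] := ub_ereal_sup_adherent d0 (fa_var_fin mu (F i)).
  rewrite sumEFin -/(variation (EFin \o mu) (F i)).
  rewrite -(fineK (fa_var_fin mu (F i))) -EFinB lte_fin => h.
  by exists n, G; split=> //; rewrite -lerBlDr ltW.
apply: (@le_trans _ _ (\sum_i (\sum_k `|mu (G i k)| + e / #|I|%:R))).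
  by apply: ler_sum => i _; have [] := GP i.
rewrite big_split/= sumr_const -(mulr_natr (e / _)) divfK ?pnatr_eq0 -?lt0n//.
rewrite lerD2r sig_big_dep/=.
apply: (fa_var_ub mu (F := fun p : {i : I & 'I_(n i)} => G (tag p) (tagged p))).
split.
  move=> [i k] [j l] _ _ /= [x [xk xl]].
  have ij : i = j.
    apply: FA.1 => //; exists x; split.
      exact: partition_of_sub (GP i).1 _ xk.
    exact: partition_of_sub (GP j).1 _ xl.
  subst j; congr existT.
  by apply: (GP i).1.1 => //; exists x.
rewrite -FA.2; apply/seteqP; split=> [x [[i k] _ /= xk]|x [i _]].
  by exists i => //; exact: partition_of_sub (GP i).1 _ xk.
by rewrite -(GP i).1.2 => -[k _ xk]; exists (Tagged (fun i => 'I_(n i)) k).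
Qed.

Lemma is_fa_var (mu : fa) : is_fa (fa_var mu).
Proof.
apply/is_faP; split=> [|A]; first exact: fa_var_additive.
exists (fa_var mu A) => I F FA.
rewrite (fa_var_additive mu FA); apply: ler_sum => i _.
by rewrite ger0_norm ?fa_var_ge0.
Qed.

Definition fa_abs (mu : fa) : fa := Fa (asboolT (is_fa_var mu)).

Lemma fa_abs_ge (mu : fa) A : `|mu A| <= fa_abs mu A.
Proof.
by apply: le_trans (fa_var_ub mu (partition_of_self A)); rewrite big_ord1.
Qed.

Lemma fa_abs_le (mu nu : fa) :
  (forall A, `|mu A| <= nu A) -> forall A, fa_abs mu A <= nu A.
Proof.
move=> h A; apply: fa_var_least => I F FA.
by rewrite (fa_additive nu FA); apply: ler_sum => i _.
Qed.

Definition fa_join (mu nu : fa) : fa := 2^-1 *: (mu + nu + fa_abs (mu - nu)).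
Definition fa_meet (mu nu : fa) : fa := 2^-1 *: (mu + nu - fa_abs (mu - nu)).

Lemma fa_leD (x y z : fa) : x <= y -> x + z <= y + z.
Proof. by move=> /fa_leP h; apply/fa_leP => A; rewrite lerD2r. Qed.

Lemma fa_leZ (a : R) (x : fa) : 0 <= a -> 0 <= x -> 0 <= a *: x.
Proof.
by move=> a0 /fa_leP h; apply/fa_leP => A; apply: mulr_ge0 => //; exact: h.
Qed.

Lemma faD (x y : fa) A : (x + y) A = x A + y A. Proof. by []. Qed.
Lemma faN (x : fa) A : (- x) A = - x A. Proof. by []. Qed.
Lemma faZ (a : R) (x : fa) A : (a *: x) A = a * x A. Proof. by []. Qed.

Lemma fa_joinP (x y z : fa) : (fa_join x y <= z) = (x <= z) && (y <= z).
Proof.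
apply/fa_leP/andP => [h|[/fa_leP xz /fa_leP yz] A].
  split; apply/fa_leP => A; have := h A; have := fa_abs_ge (x - y) A;
    rewrite ler_norml => /andP[];
    rewrite /fa_join !(faZ, faD, faN); lra.
have : fa_abs (x - y) A <= (z + z - x - y) A.
  apply: fa_abs_le => {}A; have := xz A; have := yz A.
  by rewrite ler_norml !(faD, faN) => *; apply/andP; split; lra.
rewrite /fa_join !(faZ, faD, faN); lra.
Qed.

Lemma fa_meetP (x y z : fa) : (z <= fa_meet x y) = (z <= x) && (z <= y).
Proof.
apply/fa_leP/andP => [h|[/fa_leP xz /fa_leP yz] A].
  split; apply/fa_leP => A; have := h A; have := fa_abs_ge (x - y) A;
    rewrite ler_norml => /andP[];
    rewrite /fa_meet !(faZ, faD, faN); lra.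
have : fa_abs (x - y) A <= (x + y - z - z) A.
  apply: fa_abs_le => {}A; have := xz A; have := yz A.
  by rewrite ler_norml !(faD, faN) => *; apply/andP; split; lra.
rewrite /fa_meet !(faZ, faD, faN); lra.
Qed.

HB.instance Definition _ := POrderedLmodule_isRiesz.Build R fa
  fa_leD fa_leZ fa_joinP fa_meetP.

(* The modulus of the Riesz space [fa] is the variation. *)
Lemma fa_absE (mu : fa) A :
  (riesz_abs mu A)%:E = variation (EFin \o mu) A.
Proof.
rewrite -[RHS]fineK ?fa_var_fin//; congr EFin.
suff -> : riesz_abs mu = fa_abs mu by [].
apply/le_anti/andP; split.
  rewrite riesz_joinP; apply/andP; split; apply/fa_leP => B;
    have := fa_abs_ge mu B; rewrite ler_norml ?faN => /andP[]; lra.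
have := lexx (riesz_abs mu); rewrite {1}/riesz_abs riesz_joinP.
move=> /andP[/fa_leP h /fa_leP k]; apply/fa_leP; apply: fa_abs_le => B.
by have := h B; have := k B; rewrite ler_norml faN => *; apply/andP; split; lra.
Qed.

Definition ca : set fa := [set mu | is_ca mu].

End Fa.

Arguments ca R {T} S.

(* Main.v *)
Require Import Defs.
From HB Require Import structures.
From mathcomp Require Import all_boot all_order all_algebra.
From mathcomp Require Import all_classical all_reals.
From mathcomp Require Import ereal topology normedtype sequences.
From mathcomp Require Import finmap lra.

Set Implicit Arguments.
Unset Strict Implicit.
Unset Printing Implicit Defensive.

(** The proof has an abstract half and a concrete half.

    The abstract half is the theorem of F. Riesz that in a Dedekind complete
    Riesz space every band B is a projection band
    ([band_is_projection_band]). For x >= 0 the component of x in B is the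
    supremum s of the elements of B between 0 and x. It lies in B because B is
    order closed, and x - s dominates no nonzero v >= 0 of B, as otherwise
    s + v would be an element of B between 0 and x. For an ideal B, having no
    nonzero v >= 0 of B below |y| already means that y is disjoint from B.

    The concrete half checks the two hypotheses of that theorem.

    Completeness ([fa_sup]): the supremum of a bounded upward directed set of
    charges is computed pointwise, because finite additivity passes to
    pointwise directed suprema. In particular, a net that decreases to 0 does
    so pointwise.

    The band property ([ca_band]) is read off the remainder
    mu(A) - sum_(i < n) mu(A_i) of a sequence of disjoint A_i with union A:
    a charge mu is countably additive iff all its remainders tend to 0. The
    point is that A minus A_0, ..., A_(n-1) is a finite disjoint union of
    elements of the semi-ring, so the remainder is a positive linear functional
    of mu ([remainder_le]), hence is bounded in absolute value by the remainder
    of |mu|. Solidity of ca then reduces to the fact that the variation of a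
    measure is a measure ([ca_abs]). If |u_i - mu| <= y_i with u_i in ca and
    y_i decreasing to 0, the remainder of mu differs from the one of u_i by at
    most y_i(A), which is small, so mu is in ca as well. *)

Import Order.TTheory GRing.Theory Num.Theory.
Import numFieldNormedType.Exports.

Local Open Scope classical_set_scope.
Local Open Scope ring_scope.

(** * Upward directed sets *)

Section Directed.
Context {d : Order.disp_t} {E : porderType d}.

Definition upward_directed (D : set E) : Prop :=
  forall x y, D x -> D y -> exists z, [/\ D z, (x <= z)%O & (y <= z)%O].

Lemma directed_finite_ub (I : finType) (D : set E) (f : I -> E) :
  D !=set0 -> upward_directed D ->
  (forall i, D (f i)) -> exists2 z, D z & forall i, (f i <= z)%O.
Proof.
move=> [d0 Dd0] dirD Df.
suff [z Dz zub] : exists2 z, D z & forall i, i \in enum I -> (f i <= z)%O.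
  by exists z => // i; apply: zub; rewrite mem_enum.
elim: (enum I) => [|i r [z Dz zub]]; first by exists d0.
have [w [Dw iw zw]] := dirD _ _ (Df i) Dz; exists w => // j.
by rewrite inE => /predU1P[->//|/zub fz]; exact: le_trans zw.
Qed.

End Directed.

(** * Bands in Dedekind complete Riesz spaces *)

Section RieszTheory.
Context {R : numFieldType} {E : rieszType R}.
Implicit Types (x y z v : E) (B D : set E).

Lemma riesz_leDr z x y : (x + z <= y + z) = (x <= y).
Proof.
apply/idP/idP => [|/riesz_leD]; last exact.
by move=> /riesz_leD -/(_ (- z)); rewrite !addrK.
Qed.

Lemma riesz_subr_ge0 x y : (0 <= y - x) = (x <= y).
Proof. by rewrite -(riesz_leDr x 0) subrK add0r. Qed.

Lemma riesz_leBlDr x y z : (x - y <= z) = (x <= z + y).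
Proof. by rewrite -(riesz_leDr y (x - y)) subrK. Qed.

Lemma riesz_leBrDr x y z : (x <= y - z) = (x + z <= y).
Proof. by rewrite -(riesz_leDr z x) subrK. Qed.

Lemma riesz_leD2 x y z v : x <= y -> z <= v -> x + z <= y + v.
Proof.
move=> xy zv; apply: (@le_trans _ _ (y + z)); first by rewrite riesz_leDr.
by rewrite ![y + _]addrC riesz_leDr.
Qed.

Lemma riesz_leN2 x y : (- x <= - y) = (y <= x).
Proof. by rewrite -[LHS]riesz_subr_ge0 opprK addrC riesz_subr_ge0. Qed.

Lemma riesz_join_ub x y : x <= riesz_join x y /\ y <= riesz_join x y.
Proof. by apply/andP; rewrite -riesz_joinP. Qed.

Lemma riesz_meet_lb x y : riesz_meet x y <= x /\ riesz_meet x y <= y.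
Proof. by apply/andP; rewrite -riesz_meetP. Qed.

Lemma riesz_ge_abs x : x <= riesz_abs x /\ - x <= riesz_abs x.
Proof. exact: riesz_join_ub. Qed.

Lemma riesz_abs_le x y : x <= y -> - x <= y -> riesz_abs x <= y.
Proof. by move=> xy Nxy; rewrite riesz_joinP xy. Qed.

(** Adding x <= |x| and - x <= |x| gives 0 <= 2 |x|, which is then scaled by
    1 / 2. *)
Lemma riesz_abs_ge0 x : 0 <= riesz_abs x.
Proof.
have [xx Nxx] := riesz_ge_abs x.
have := riesz_leD2 xx Nxx; rewrite subrr -mulr2n -scaler_nat => h.
have := @riesz_leZ R E 2^-1 _ _ h; rewrite scalerA mulVf ?pnatr_eq0// scale1r.
by apply; rewrite invr_ge0.
Qed.

Lemma riesz_leNid x : 0 <= x -> - x <= x.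
Proof. by move=> x0; apply: (le_trans _ x0); rewrite -oppr0 riesz_leN2. Qed.

Lemma riesz_ger0_abs x : 0 <= x -> riesz_abs x = x.
Proof.
move=> x0; apply/le_anti; rewrite (riesz_ge_abs x).1 andbT.
by apply: riesz_abs_le => //; exact: riesz_leNid.
Qed.

Lemma riesz_absB x y : 0 <= x -> 0 <= y -> riesz_abs (x - y) <= x + y.
Proof.
move=> x0 y0; apply: riesz_abs_le; first by rewrite riesz_leD2// riesz_leNid.
by rewrite opprB addrC riesz_leD2// riesz_leNid.
Qed.

Lemma riesz_abs_eq0 x : riesz_abs x = 0 -> x = 0.
Proof.
have [+ +] := riesz_ge_abs x => /[swap] + + x0; rewrite x0 => Nx_le0 x_le0.
by apply/le_anti; rewrite x_le0 -riesz_leN2 oppr0.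
Qed.

Lemma ideal0 B : is_ideal B -> B 0. Proof. by case=> -[]. Qed.

Lemma idealD B x y : is_ideal B -> B x -> B y -> B (x + y).
Proof. by case=> -[_ lin] _ Bx By; rewrite -[x]scale1r; exact: lin. Qed.

Lemma idealB B x y : is_ideal B -> B x -> B y -> B (x - y).
Proof. by case=> -[_ lin] _ Bx By; rewrite addrC -scaleN1r; exact: lin. Qed.

Lemma ideal_ge0_le B x y : is_ideal B -> 0 <= x -> x <= y -> B y -> B x.
Proof.
move=> [_ sol] x0 xy; apply: sol; rewrite !riesz_ger0_abs//.
exact: le_trans xy.
Qed.

Lemma ideal_abs B x : is_ideal B -> B x -> B (riesz_abs x).
Proof.
by move=> [_ sol]; apply: sol; rewrite riesz_ger0_abs ?riesz_abs_ge0.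
Qed.

(** By solidity |x| /\ |y| is itself an element of B between 0 and |x|. *)
Lemma ideal_disjoint_complement B x : is_ideal B ->
  (forall v, B v -> 0 <= v -> v <= riesz_abs x -> v = 0) ->
  disjoint_complement B x.
Proof.
move=> idB triv y By; have [lx ly] := riesz_meet_lb (riesz_abs x) (riesz_abs y).
have ge0 : 0 <= riesz_meet (riesz_abs x) (riesz_abs y).
  by rewrite riesz_meetP !riesz_abs_ge0.
by apply: triv => //; apply: ideal_ge0_le ly _ => //; exact: ideal_abs.
Qed.

Lemma ideal_setI_disjoint_complement B : is_ideal B ->
  B `&` disjoint_complement B = [set 0].
Proof.
move=> idB; apply/seteqP; split=> [x [Bx /(_ x Bx) dx]|_ ->] /=.
  apply/riesz_abs_eq0/le_anti; rewrite riesz_abs_ge0 andbT.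
  by rewrite -dx riesz_meetP lexx.
split; first exact: ideal0.
apply: ideal_disjoint_complement => // v _ v0 vle; apply/le_anti.
by rewrite v0 andbT; rewrite riesz_ger0_abs in vle.
Qed.

(** In a Riesz space this is Dedekind completeness: closing a bounded set under
    finite joins makes it directed and keeps its upper bounds. *)
Definition directed_complete : Prop := forall D : set E,
  D !=set0 -> upward_directed D -> ubound D !=set0 -> supremums D !=set0.

(** The elements of D, indexed by D itself, form a net that order converges
    to s, dominated by the differences s - d. *)
Lemma order_closed_sup B D s : order_closed B ->
  D !=set0 -> upward_directed D -> D `<=` B -> supremums D s -> B s.
Proof.
move=> clB [d0 Dd0] dirD DB [ubs leasts].
pose I := {x : E | D x}.
apply: (clB I (fun i j => sval i <= sval j) sval).
- split=> [|//|i j k|[x Dx] [y Dy]]; first exact: (inhabits (exist _ d0 Dd0)).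
    exact: le_trans.
  by have [z [Dz xz yz]] := dirD _ _ Dx Dy; exists (exist _ z Dz).
- by move=> [x Dx]; exact: DB.
exists (fun i => s - sval i); split.
  split=> [i j ij|]; first by rewrite riesz_leD2// riesz_leN2.
  split=> [_ [[x Dx] _ <-]|w lbw] /=; first by rewrite riesz_subr_ge0 ubs.
  have : s <= s - w.
    apply: leasts => x Dx.
    have /lbw : range (fun i : I => s - sval i) (s - x).
      by exists (exist _ x Dx).
    by rewrite !riesz_leBrDr addrC.
  by rewrite riesz_leBrDr addrC -{2}[s]add0r riesz_leDr.
move=> [x Dx] /=; apply: riesz_abs_le; last by rewrite opprB.
by rewrite -opprB riesz_leNid// riesz_subr_ge0 ubs.
Qed.

(** The component b of x in B is the supremum of the elements of B in [0, x];
    the last clause expresses the disjointness of x - b from B. *)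
Lemma band_decomposition_ge0 B x : directed_complete -> is_band B -> 0 <= x ->
  exists b, [/\ B b, 0 <= x - b &
    forall v, B v -> 0 <= v -> v <= x - b -> v = 0].
Proof.
move=> dcE [idB clB] x0.
pose D := [set v | [/\ B v, 0 <= v & v <= x]].
have D0 : D !=set0 by exists 0; split=> //; exact: ideal0.
have dirD : upward_directed D.
  move=> v w [Bv v0 vx] [Bw w0 wx]; have [vj wj] := riesz_join_ub v w.
  have j0 := le_trans v0 vj.
  exists (riesz_join v w); split=> //; split=> //; last first.
    by rewrite riesz_joinP vx.
  apply: (@ideal_ge0_le B _ (v + w)) => //; last exact: idealD.
  by rewrite riesz_joinP -{1}[v]addr0 -{2}[w]add0r !riesz_leD2.
have [s sups] : supremums D !=set0.
  by apply: dcE => //; exists x => v [].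
have Bs : B s by apply: order_closed_sup sups => // v [].
have [ubs leasts] := sups; exists s; split=> //.
  by rewrite riesz_subr_ge0; apply: leasts => v [].
move=> v Bv v0 vxs; apply/le_anti; rewrite v0 andbT.
have : s <= s - v.
  apply: leasts => w [Bw w0 wx].
  rewrite -(riesz_leDr v w) subrK; apply: (ubs); split; first exact: idealD.
    by rewrite -[0]addr0 riesz_leD2.
  by rewrite -(subrKC s x) riesz_leD2//; exact: ubs.
by rewrite riesz_leBrDr addrC -{2}[s]add0r riesz_leDr.
Qed.

(** A general x is the difference of the positive elements |x| and |x| - x.
    The difference c - c' of the resulting remainders is bounded by c + c', and
    an element of B in [0, c + c'] vanishes: its meet with c is 0, so it is
    below c'. *)
Theorem band_is_projection_band B :
  directed_complete -> is_band B -> is_projection_band B.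
Proof.
move=> dcE bB; have [idB _] := bB; split=> //; split; last first.
  exact: ideal_setI_disjoint_complement.
move=> x; have [xle _] := riesz_ge_abs x.
have [b [Bb c0 trivc]] := band_decomposition_ge0 dcE bB (riesz_abs_ge0 x).
have [|b' [Bb' c'0 trivc']] :=
  @band_decomposition_ge0 B (riesz_abs x - x) dcE bB.
  by rewrite riesz_subr_ge0.
set c := riesz_abs x - b in c0 trivc.
set c' := riesz_abs x - x - b' in c'0 trivc'.
exists (b - b'), (c - c'); split; first exact: idealB.
  apply: ideal_disjoint_complement => // v Bv v0 vcc'.
  have {}vcc' := le_trans vcc' (riesz_absB c0 c'0).
  have [mv mc] := riesz_meet_lb v c.
  have m0 : riesz_meet v c = 0.
    have ge0 : 0 <= riesz_meet v c by rewrite riesz_meetP v0.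
    by apply: trivc => //; exact: ideal_ge0_le mv _.
  apply: trivc' => //; rewrite -riesz_subr_ge0 -riesz_leN2 opprB oppr0 -m0.
  rewrite riesz_meetP !riesz_leBlDr vcc' andbT.
  by rewrite -{1}[v]addr0 riesz_leD2.
by rewrite addrACA -opprD [b + _]addrC subrK [b' + _]addrC subrK subKr.
Qed.

End RieszTheory.

(** * Differences in a semi-ring *)

Section Semiring.
Context {T : Type} (S : semiring_of_sets T).

(** The finite set of blocks of A \ B becomes a family indexed by its own
    elements. *)
Lemma semiring_setD_partition (A B : S) : exists (J : finType) (G : J -> S),
  trivIset setT (fun j => val (G j)) /\
  \bigcup_j val (G j) = val A `\` val B.
Proof.
have [D [finD DS -> trivD]] := semiring_setD (set_valP A) (set_valP B).
have [X DX] := (finite_fsetP (T := set T)).1 finD.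
have XS (j : X) : val j \in (S : set (set T)).
  by apply/mem_set/DS; rewrite DX /=; exact: valP.
exists X, (fun j => exist _ (val j) (XS j)); split=> [i j _ _ /=|].
  move=> /trivD ij; apply/val_inj/ij; rewrite DX /=; exact: valP.
rewrite DX; apply/seteqP; split=> [x [j _ jx]|x [Y YX Yx]].
  by exists (val j) => //=; exact: valP.
by exists [` YX]%fset.
Qed.

(** Induction on n: every block of the previous difference is cut again by
    removing F n from it. *)
Lemma semiring_setD_bigcup (A : S) (F : nat -> S) n :
  exists (J : finType) (G : J -> S),
  trivIset setT (fun j => val (G j)) /\
  \bigcup_j val (G j) = val A `\` \bigcup_(i < n) val (F i).
Proof.
elim: n => [|n [J [G [trivG UG]]]].
  exists unit, (fun=> A); split=> [[] []//|].
  rewrite bigcup_mkord big_ord0 setD0.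
  by apply/seteqP; split=> [x []//|x Ax]; exists tt.
have /fin_all_exists[K /fin_all_exists[H HP]] :=
  fun j => semiring_setD_partition (G j) (F n).
exists {j : J & K j}, (fun p => H (tag p) (tagged p)); split.
  move=> [i k] [j l] _ _ /= [x [xk xl]].
  have HG i' k' : val (H i' k') `<=` val (G i').
    move=> y yk; suff: (val (G i') `\` val (F n)) y by case.
    by rewrite -(HP i').2; exists k'.
  (* Blocks cut from different G i and G j are disjoint as G i and G j are. *)
  have ij : i = j.
    by apply: trivG => //; exists x; split; [exact: HG xk|exact: HG xl].
  by subst j; congr existT; apply: (HP i).1 => //; exists x.
have -> : \bigcup_(i < n.+1) val (F i) =
    \bigcup_(i < n) val (F i) `|` val (F n).
  by rewrite !bigcup_mkord big_ord_recr.
rewrite -setDDl -UG setD_bigcupl.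
apply/seteqP; split=> [x [[j k] _ /= xk]|x [j _]].
  by exists j => //; rewrite -(HP j).2; exists k.
by rewrite -(HP j).2 => -[k _ xk]; exists (Tagged K k).
Qed.

(** A finite piece of a countable partition extends to a finite partition, so
    that finite additivity applies to it. *)
Lemma partition_of_prefix (A : S) (F : nat -> S) n : is_partition_of F A ->
  exists (J : finType) (G : J -> S), is_partition_of
    (fun s : 'I_n + J => match s with inl i => F i | inr j => G j end) A.
Proof.
move=> FA; have [J [G [trivG UG]]] := semiring_setD_bigcup A F n.
have disj (i : 'I_n) j x : val (F i) x -> ~ val (G j) x.
  move=> Fx Gx; have : (\bigcup_j val (G j)) x by exists j.
  by rewrite UG => -[_]; apply; exists (val i) => //=.
exists J, G; split.
  move=> [i|i] [j|j] _ _ /= [x [xi xj]]; rewrite ?(disj _ _ _ xi xj)//.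
  - by congr inl; apply/val_inj/FA.1 => //; exists x.
  - by case: (disj _ _ _ xi xj).
  - by case: (disj _ _ _ xj xi).
  - by congr inr; apply: trivG => //; exists x.
apply/seteqP; split=> [x [[i|j] _ /= xi]|x Ax].
- exact: partition_of_sub FA _ xi.
- have : (\bigcup_j val (G j)) x by exists j.
  by rewrite UG => -[].
have [[i /= ilt Fx]|nF] := pselect ((\bigcup_(i < n) val (F i)) x).
  by exists (inl (Ordinal ilt)).
have : (\bigcup_j val (G j)) x by rewrite UG; split.
by move=> [j _ Gx]; exists (inr j).
Qed.

End Semiring.

(** * Directed suprema of charges *)

Section FaSup.
Context {R : realType} {T : Type} {S : semiring_of_sets T}.
Implicit Types (mu nu : fa R S) (D : set (fa R S)).

(** The pointwise supremum s is additive: <= holds for each d in D, and for >=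
    directedness provides one z in D that is nearly s on all the blocks at once.
    Its variation is finite because s lies between two charges. *)
Lemma fa_sup D : D !=set0 -> upward_directed D -> ubound D !=set0 ->
  exists2 s : fa R S, supremums D s &
    forall A, s A = sup [set (d : fa R S) A | d in D].
Proof.
move=> D0 dirD [u ubu]; have [d0 Dd0] := D0.
pose s A : R := sup [set (d : fa R S) A | d in D].
have supD A : has_sup [set (d : fa R S) A | d in D].
  split; first by exists (d0 A), d0.
  by exists (u A) => _ [d Dd <-]; exact/fa_leP/ubu.
have les d A : D d -> d A <= s A.
  by move=> Dd; apply: sup_upper_bound => //; exists d.
have leu w A : ubound D w -> s A <= w A.
  move=> ubw; apply: ge_sup; first by have [] := supD A.
  by move=> _ [d Dd <-]; exact/fa_leP/ubw.
have fas : is_fa s.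
  apply/is_faP; split=> [I F A FA|A].
    apply/le_anti/andP; split.
      apply: ge_sup; first by have [] := supD A.
      move=> _ [d Dd <-]; rewrite (fa_additive d FA).
      by apply: ler_sum => i _; exact: les.
    apply/ler_addgt0Pr => e e0.
    (* The denominator #|I| + 1 is positive even if the partition is empty. *)
    pose e' := e / (#|I|%:R + 1).
    have e'0 : 0 < e' by rewrite divr_gt0// ltr_wpDl.
    have /fin_all_exists2[d Dd dP] :
        forall i, exists2 d, D d & s (F i) - e' < d (F i).
      move=> i; have [_ [d Dd <-] ?] := sup_adherent e'0 (supD (F i)).
      by exists d.
    have [z Dz zub] := directed_finite_ub D0 dirD Dd.
    apply: (@le_trans _ _ (\sum_i (z (F i) + e'))).
      apply: ler_sum => i _; rewrite -lerBlDr; apply: le_trans (ltW (dP i)) _.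
      exact/fa_leP/zub.
    rewrite big_split/= -(fa_additive z FA) lerD ?les// sumr_const.
    rewrite -mulr_natr /e' mulrAC ler_pdivrMr ?ltr_wpDl//.
    by rewrite ler_wpM2l ?(ltW e0)// lerDl.
  (* From d0 <= s <= u follows |s| <= |d0| + |u|. *)
  exists (fa_abs d0 A + fa_abs u A) => I F FA.
  rewrite (fa_additive (fa_abs d0) FA) (fa_additive (fa_abs u) FA) -big_split.
  apply: ler_sum => i _ /=.
  have := fa_abs_ge d0 (F i); have := fa_abs_ge u (F i).
  have := les d0 (F i) Dd0; have := leu u (F i) ubu.
  rewrite /= !ler_norml => + + /andP[? ?] /andP[? ?] => ? ?.
  by apply/andP; split; lra.
exists (Fa (asboolT fas)) => //; split=> [d Dd|w ubw].
  by apply/fa_leP => A; exact: les.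
by apply/fa_leP => A; exact: leu.
Qed.

Lemma fa_directed_complete : @directed_complete R (fa R S).
Proof.
by move=> D D0 dirD ubD; have [s sups _] := fa_sup D0 dirD ubD; exists s.
Qed.

End FaSup.

(** * Countably additive charges *)

Section Ca.
Context {R : realType} {T : Type} {S : semiring_of_sets T}.
Implicit Types (mu nu : fa R S) (F : nat -> S) (A : S).

Lemma riesz_abs_fa_var mu A : riesz_abs mu A = fa_var mu A.
Proof. by apply: EFin_inj; rewrite fa_absE fineK ?fa_var_fin. Qed.

Definition remainder mu F A n : R := mu A - \sum_(0 <= i < n) mu (F i).

Lemma remainder_linear (a : R) mu nu F A n :
  remainder (a *: mu + nu) F A n = a * remainder mu F A n + remainder nu F A n.
Proof.
by rewrite /remainder mulrBr mulr_sumr addrACA -opprD -big_split.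
Qed.

Lemma remainderB mu nu F A n :
  remainder (mu - nu) F A n = remainder mu F A n - remainder nu F A n.
Proof. by rewrite addrC -scaleN1r remainder_linear mulN1r addrC. Qed.

Lemma remainder0 F A n : remainder 0 F A n = 0.
Proof. by rewrite /remainder big1// subr0. Qed.

(** The remainder is the sum of the charge over the blocks that complete
    F 0, ..., F (n - 1) to a finite partition of A, so it is monotone in the
    charge. *)
Lemma remainder_le mu nu F A n : is_partition_of F A -> mu <= nu ->
  remainder mu F A n <= remainder nu F A n.
Proof.
move=> FA /fa_leP munu; have [J [G FGA]] := partition_of_prefix n FA.
have remE (la : fa R S) : remainder la F A n = \sum_j la (G j).
  rewrite /remainder (fa_additive la FGA) big_sumType/= big_mkord.
  by rewrite addrAC subrr add0r.
by rewrite !remE; apply: ler_sum => j _.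
Qed.

Lemma remainder_ge0 mu F A n : is_partition_of F A -> 0 <= mu ->
  0 <= remainder mu F A n.
Proof. by move=> FA /(remainder_le n FA); rewrite remainder0. Qed.

Lemma norm_remainder_le mu F A n : is_partition_of F A ->
  `|remainder mu F A n| <= remainder (riesz_abs mu) F A n.
Proof.
move=> FA; have [mule Nmule] := riesz_ge_abs mu.
rewrite ler_norml lerNl (remainder_le n FA mule) andbT.
have -> : - remainder mu F A n = remainder (- mu) F A n.
  by rewrite -[- mu]add0r remainderB remainder0 sub0r.
exact: remainder_le.
Qed.

Lemma remainder_le_measure mu F A n : 0 <= mu -> remainder mu F A n <= mu A.
Proof.
move=> /fa_leP mu0; rewrite /remainder gerBl.
by apply: sumr_ge0 => i _; exact: mu0.
Qed.

Lemma caP mu : ca R S mu <-> forall F A, is_partition_of F A ->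
  remainder mu F A n @[n --> \oo] --> (0 : R).
Proof.
have cvgE F A : (fun n => \sum_(0 <= i < n) (EFin \o mu) (F i))%E @ \oo
      --> (mu A)%:E <-> remainder mu F A n @[n --> \oo] --> (0 : R).
  rewrite (_ : (fun n => _) = EFin \o (fun n => \sum_(0 <= i < n) mu (F i)));
    last by apply/funext => n; rewrite /= -sumEFin.
  split=> [/fine_cvgP[_ /= cvg]|cvg].
    rewrite -(subrr (mu A)); apply: cvgB => //; exact: cvg_cst.
  apply/fine_cvgP; split; first by near=> n.
  suff : mu A - remainder mu F A n @[n --> \oo] --> mu A - 0.
    rewrite subr0; under eq_fun do rewrite /remainder subKr.
    exact.
  by apply: cvgB => //; exact: cvg_cst.
split=> [[[_ cvg] _] F A FA|cvg].
  by apply/cvgE; exact: cvg.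
have [chmu varmu] := fa_is_fa mu.
split=> //; split=> // F A FA; apply/cvgE; exact: cvg.
Unshelve. all: by end_near. Qed.

Lemma ca_vector_subspace : vector_subspace (ca R S).
Proof.
split=> [|a mu nu /caP cmu /caP cnu].
  apply/caP => F A FA; rewrite (_ : remainder 0 F A = fun=> 0).
    exact: cvg_cst.
  by apply/funext => n; rewrite remainder0.
apply/caP => F A FA; have -> : (0 : R) = a * 0 + 0 by rewrite mulr0 addr0.
under eq_fun do rewrite remainder_linear.
apply: cvgD; last exact: cnu.
by apply: cvgM; [exact: cvg_cst|exact: cmu].
Qed.

(** The partial sums of |mu|(F k) increase to a limit at most |mu|(A). It is at
    least |mu|(A): for a finite partition C of A, countable additivity of mu on
    each C i writes sum_i |mu(C i)| as the limit of
    sum_i |sum_(k < n) mu(C i & F k)|, which is at most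
    sum_(k < n) |mu|(F k). *)
Lemma ca_abs mu : ca R S mu -> ca R S (riesz_abs mu).
Proof.
move=> /caP cmu; apply/caP => F A FA.
pose a n := \sum_(0 <= i < n) riesz_abs mu (F i).
have abs0 : 0 <= riesz_abs mu := riesz_abs_ge0 mu.
have a_nd : nondecreasing_seq a.
  apply/nondecreasing_seqP => n; rewrite /a big_nat_recr//= lerDl.
  by move/fa_leP: abs0; exact.
have aA n : a n <= riesz_abs mu A.
  by rewrite -subr_ge0; exact: remainder_ge0.
have a_cvg : cvgn a.
  apply: nondecreasing_is_cvgn => //; exists (riesz_abs mu A) => _ [n _ <-].
  exact: aA.
suff limaE : limn a = riesz_abs mu A.
  rewrite -(subrr (riesz_abs mu A)); apply: cvgB; first exact: cvg_cst.
  by rewrite -limaE.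
apply/le_anti/andP; split; first by apply: limr_le => //; near=> n.
rewrite riesz_abs_fa_var; apply: fa_var_least => I C CA.
have CF (i : I) : is_partition_of (fun n => semiringI (C i) (F n)) (C i).
  by apply: partition_ofI FA _; exact: partition_of_sub CA.
pose b (i : I) n := \sum_(0 <= k < n) mu (semiringI (C i) (F k)).
have b_cvg i : b i n @[n --> \oo] --> mu (C i).
  rewrite -[mu (C i)]subr0.
  rewrite (_ : b i = fun n => mu (C i) -
      remainder mu (fun n => semiringI (C i) (F n)) (C i) n); last first.
    by apply/funext => n; rewrite /remainder subKr.
  by apply: cvgB; [exact: cvg_cst|exact: cmu].
have : \sum_i `|b i n| @[n --> \oo] --> \sum_i `|mu (C i)|.
  apply: cvg_big => [|i _]; first exact: add_continuous.
  by apply: cvg_norm.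
move=> /ler_cvg_to; apply; first exact: a_cvg.
near=> n.
apply: (@le_trans _ _ (\sum_i \sum_(0 <= k < n) `|mu (semiringI (C i) (F k))|)).
  by apply: ler_sum => i _; exact: ler_norm_sum.
rewrite exchange_big; apply: ler_sum => k _; rewrite riesz_abs_fa_var.
under eq_bigr => i _.
  have -> : semiringI (C i) (F k) = semiringI (F k) (C i).
    by apply: val_inj; rewrite /= setIC.
  over.
by apply/fa_var_ub/(partition_ofI CA); exact: partition_of_sub FA.
Unshelve. all: by end_near. Qed.

(** |remainder of mu| <= remainder of |mu| <= remainder of |nu|, and |nu| is
    countably additive. *)
Lemma ca_solid : solid (ca R S).
Proof.
move=> mu nu munu /ca_abs/caP cnu; apply/caP => F A FA.
apply/cvgr0Pnorm_le => e e0; have /cvgr0Pnorm_le/(_ e e0) := cnu F A FA.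
apply: filterS => n; apply: le_trans.
apply: le_trans (norm_remainder_le mu n FA) _.
by apply: le_trans (ler_norm _); exact: remainder_le.
Qed.

(** The infimum of a net of charges in fa is a priori not pointwise; for a
    directed net it is, by [fa_sup] applied to the opposite charges. *)
Lemma fa_decreases_to0_pointwise (I : Type) (le : I -> I -> Prop)
  (y : I -> fa R S) A e : is_directed le -> decreases_to0 le y -> 0 < e ->
  exists i, y i A < e.
Proof.
move=> [[i0] _ _ dir] [ydec [y_ge0 infy]] e0.
pose D := range (fun i => - y i).
have [|||s sups sE] := @fa_sup R T S D.
- by exists (- y i0), i0.
- move=> _ _ [i _ <-] [j _ <-]; have [k [ik jk]] := dir i j.
  by exists (- y k); split; [exists k| |]; rewrite ?riesz_leN2//; exact: ydec.
- exists 0 => _ [i _ <-]; rewrite -oppr0 riesz_leN2.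
  by apply: y_ge0; exists i.
have s0 : 0 <= s.
  rewrite -riesz_leN2 oppr0; apply: infy => _ [i _ <-].
  by rewrite -[y i]opprK riesz_leN2; apply: sups.1; exists i.
have sA : has_sup [set (d : fa R S) A | d in D].
  split; first by exists ((- y i0) A), (- y i0) => //; exists i0.
  by exists (s A) => _ [d Dd <-]; exact/fa_leP/sups.1.
have [_ [_ [i _ <-] <-]] := sup_adherent e0 sA.
rewrite -sE faN => h; exists i.
have sA0 : 0 <= s A by move/fa_leP: s0; exact.
lra.
Qed.

(** The bound y i A on the remainder of u i - mu is uniform in n, so i can be
    fixed before n grows. *)
Lemma ca_order_closed : order_closed (ca R S).
Proof.
move=> I le u mu dir cu [y [ydec ule]]; apply/caP => F A FA.
apply/cvgr0Pnorm_le => e e0; have e20 : 0 < e / 2 by rewrite divr_gt0.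
have [i yi] := fa_decreases_to0_pointwise A dir ydec e20.
have /caP/(_ F A FA)/cvgr0Pnorm_le/(_ _ e20) := cu i.
apply: filterS => n rn.
have yi0 : 0 <= y i by apply: ydec.2.1; exists i.
have : `|remainder (u i - mu) F A n| <= y i A.
  apply: le_trans (norm_remainder_le _ n FA) _.
  apply: le_trans (remainder_le n FA (ule i)) _.
  exact: remainder_le_measure.
rewrite remainderB; move: rn yi; rewrite !ler_norml.
by move=> /andP[? ?] ? /andP[? ?]; apply/andP; split; lra.
Qed.

Lemma ca_band : is_band (ca R S).
Proof.
split; last exact: ca_order_closed.
by split; [exact: ca_vector_subspace|exact: ca_solid].
Qed.

End Ca.

Theorem theorem4p6 (R : realType) (T : Type) (S : semiring_of_sets T) :
  is_projection_band (ca R S) /\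
  direct_sum_decomposition (ca R S) (disjoint_complement (ca R S)).
Proof.
have caB : is_projection_band (ca R S).
  by apply: band_is_projection_band ca_band; exact: fa_directed_complete.
by split=> //; case: caB.
Qed.
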